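(* Let $K, M \ge 2$ be integers, $\mathcal{D} = \{0,1,\ldots,K-1\}$, $\mathcal{Y} = \{0,1,\ldots,M-1\}$, let $\mathcal{X}$ be a finite set, and let $\mathcal{Z} = \mathcal{D}\times\mathcal{Y}^{\mathcal{D}}\times\mathcal{X}$. Let $\succsim$ be a binary relation on $\Delta(\mathcal{Z})$. The following are equivalent: (1) $\succsim$ satisfies Completeness, Transitivity, Independence, Continuity and Irrelevance of Counterfactual Correlation; (2) there exists an additive utility, i.e. a function $\tilde u:\mathcal{Z}\to\mathbb{R}$ of the form $\tilde u(d;\mathbf{y},\mathbf{x})=\sum_{k\in\mathcal{D}}u_k(d;y_k,\mathbf{x})$ for some functions $u_k:\mathcal{D}\times\mathcal{Y}\times\mathcal{X}\to\mathbb{R}$, $k\in\mathcal{D}$, that represents $\succsim$. Moreover, the utility function $\tilde u$ is unique up to a positive affine transformation, i.e. if $\tilde u$ and $\tilde v$ are additive utilities both representing $\succsim$, then there are $a>0$ and $b\in\mathbb{R}$ with $\tilde v = a\tilde u + b$.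
   Context: $\Delta(S)$ denotes the set of probability measures on a finite set $S$; $\delta_z$ is the Dirac measure at $z$. Elements of $\mathcal{Z}$ are written $(d,\mathbf{y},\mathbf{x})$ with $d\in\mathcal{D}$ (decision), $\mathbf{y}=(y_0,\ldots,y_{K-1})\in\mathcal{Y}^{\mathcal{D}}$ (potential outcomes) and $\mathbf{x}\in\mathcal{X}$ (covariates). On $\mathcal{Z}$, $D$, $Y(k)$ ($k\in\mathcal{D}$) and $\mathbf{X}$ denote the coordinate maps $(d,\mathbf{y},\mathbf{x})\mapsto d$, $y_k$, $\mathbf{x}$. A policy is a map $\pi:\mathcal{Y}^{\mathcal{D}}\times\mathcal{X}\to\Delta(\mathcal{D})$, and a state of nature is $P\in\Delta(\mathcal{Y}^{\mathcal{D}}\times\mathcal{X})$. The pair $(\pi,P)$ induces $P^\pi\in\Delta(\mathcal{Z})$ by $P^\pi(d,\mathbf{y},\mathbf{x})=\pi(d;\mathbf{y},\mathbf{x})P(\mathbf{y},\mathbf{x})$; every element of $\Delta(\mathcal{Z})$ is of this form. For $\tilde u:\mathcal{Z}\to\mathbb{R}$ the value is $V_P(\pi;\tilde u)=\sum_{(d,\mathbf{y},\mathbf{x})\in\mathcal{Z}}\tilde u(d;\mathbf{y},\mathbf{x})P^\pi(d,\mathbf{y},\mathbf{x})$. The relation $\succsim$ is represented by $\tilde u$ if for all $P^\pi,Q^\rho\in\Delta(\mathcal{Z})$: $P^\pi\succsim Q^\rho \iff V_P(\pi;\tilde u)\ge V_Q(\rho;\tilde u)$ (equivalently, for all $p,q\in\Delta(\mathcal{Z})$: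 $p\succsim q\iff \sum_z\tilde u(z)p(z)\ge\sum_z\tilde u(z)q(z)$). Write $p\succ q$ if $p\succsim q$ but not $q\succsim p$, and $p\sim q$ if $p\succsim q$ and $q\succsim p$. Mixtures are pointwise. Axioms: Completeness: for all $p,q\in\Delta(\mathcal{Z})$, $p\succsim q$ or $q\succsim p$. Transitivity: for all $p,q,r\in\Delta(\mathcal{Z})$, if $p\succsim q$ and $q\succsim r$ then $p\succsim r$. Independence: for all $p,q,r\in\Delta(\mathcal{Z})$ and $\alpha\in(0,1]$, if $p\succ q$ then $\alpha p+(1-\alpha)r\succ\alpha q+(1-\alpha)r$. Continuity: for all $p,q,r\in\Delta(\mathcal{Z})$, if $p\succ q\succ r$ then there exist $\alpha,\beta\in(0,1)$ with $\alpha p+(1-\alpha)r\succ q\succ\beta p+(1-\beta)r$. Irrelevance of Counterfactual Correlation: for all $p,q\in\Delta(\mathcal{Z})$, $d\in\mathcal{D}$ and $\mathbf{x}\in\mathcal{X}$, if (i) $p(D=k)=q(D=k)=\delta_d(k)$ for all $k\in\mathcal{D}$, (ii) $p(\mathbf{X}=\mathbf{x}')=q(\mathbf{X}=\mathbf{x}')=\delta_{\mathbf{x}}(\mathbf{x}')$ for all $\mathbf{x}'\in\mathcal{X}$, and (iii) $p(Y(k)=y)=q(Y(k)=y)$ for all $k\in\mathcal{D}$ and all $y\in\mathcal{Y}$, then $p\sim q$. *)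

(* Defs.v *)
From HB Require Import structures.
From mathcomp Require Import all_boot all_order all_algebra.
From mathcomp Require Import interval_inference reals.

Set Implicit Arguments.
Unset Strict Implicit.
Unset Printing Implicit Defensive.

Import Order.TTheory GRing.Theory Num.Theory.
Local Open Scope ring_scope.

(* The side condition is boolean, so two distributions with the same
   probability mass function are Leibniz-equal. *)
Record dist (R : realType) (S : finType) : Type := Dist {
  pmf :> {ffun S -> R};
  distP : [forall s, 0 <= pmf s] && (\sum_s pmf s == 1) }.

HB.instance Definition _ (R : realType) (S : finType) :=
  [isSub for @pmf R S].

Definition Pr (R : realType) (S : finType) (p : dist R S) (E : pred S) : R :=
  \sum_(s | E s) p s.

Lemma dist_ge0 (R : realType) (S : finType) (p : dist R S) s : 0 <= p s.
Proof. by case/andP: (distP p) => /forallP. Qed.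

Lemma dist_sum1 (R : realType) (S : finType) (p : dist R S) : \sum_s p s = 1.
Proof. by case/andP: (distP p) => _ /eqP. Qed.

Fact dirac_subproof (R : realType) (S : finType) (z : S) :
  let f := [ffun s => (s == z)%:R : R] in
  [forall s, 0 <= f s] && (\sum_s f s == 1).
Proof.
apply/andP; split; first by apply/forallP => s; rewrite ffunE ler0n.
by rewrite (bigD1 z) //= big1 ?ffunE ?eqxx ?addr0 // => s /negPf nsz;
  rewrite ffunE nsz.
Qed.

Definition dirac (R : realType) (S : finType) (z : S) : dist R S :=
  Dist (dirac_subproof R z).

Fact mix_subproof (R : realType) (S : finType) (a : {i01 R}) (p q : dist R S) :
  let f := [ffun s => a%:num * p s + (1 - a%:num) * q s] in
  [forall s, 0 <= f s] && (\sum_s f s == 1).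
Proof.
apply/andP; split.
  by apply/forallP => s; rewrite ffunE addr_ge0 // mulr_ge0 ?dist_ge0.
under eq_bigr do rewrite ffunE.
by rewrite big_split /= -!mulr_sumr !dist_sum1 !mulr1 subrKC.
Qed.

Definition mix (R : realType) (S : finType) (a : {i01 R}) (p q : dist R S) :
  dist R S := Dist (mix_subproof a p q).

(* Decisions are ['I_K], outcomes ['I_M]; ['I_K -> 'I_M] as a finite function is
   the vector of potential outcomes. *)
Definition Omega (K M : nat) (X : finType) : finType :=
  ({ffun 'I_K -> 'I_M} * X)%type.

Definition calZ (K M : nat) (X : finType) : finType :=
  ('I_K * {ffun 'I_K -> 'I_M} * X)%type.

Definition coordD (K M : nat) (X : finType) (z : calZ K M X) : 'I_K := z.1.1.
Definition coordY (K M : nat) (X : finType) (k : 'I_K) (z : calZ K M X) : 'I_M :=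
  z.1.2 k.
Definition coordX (K M : nat) (X : finType) (z : calZ K M X) : X := z.2.

Definition policy (R : realType) (K M : nat) (X : finType) : Type :=
  {ffun 'I_K -> 'I_M} -> X -> dist R 'I_K.

Fact induced_subproof (R : realType) (K M : nat) (X : finType)
    (P : dist R (Omega K M X)) (pi : policy R K M X) :
  let f := [ffun z : calZ K M X => pi z.1.2 z.2 z.1.1 * P (z.1.2, z.2)] in
  [forall z, 0 <= f z] && (\sum_z f z == 1).
Proof.
apply/andP; split.
  by apply/forallP => z; rewrite ffunE mulr_ge0 ?dist_ge0.
under eq_bigr do rewrite ffunE.
rewrite -(pair_big xpredT xpredT (fun (dy : 'I_K * {ffun 'I_K -> 'I_M}) x =>
  pi dy.2 x dy.1 * P (dy.2, x))) /=.
rewrite -(pair_big xpredT xpredT (fun (d : 'I_K) (y : {ffun 'I_K -> 'I_M}) =>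
  \sum_x pi y x d * P (y, x))) /=.
rewrite exchange_big /= -(dist_sum1 P).
rewrite -(eq_bigr _ (fun (yx : Omega K M X) _ =>
  congr1 (fun w => P w) (esym (surjective_pairing yx)))).
rewrite -(pair_big xpredT xpredT (fun (y : {ffun 'I_K -> 'I_M}) x =>
  P (y, x))) /=.
apply/eqP; apply: eq_bigr => y _; rewrite exchange_big; apply: eq_bigr => x _.
by rewrite -mulr_suml dist_sum1 mul1r.
Qed.

(* The distribution P^pi of (D, Y, X). *)
Definition induced (R : realType) (K M : nat) (X : finType)
    (P : dist R (Omega K M X)) (pi : policy R K M X) : dist R (calZ K M X) :=
  Dist (induced_subproof P pi).

Definition value (R : realType) (K M : nat) (X : finType)
    (P : dist R (Omega K M X)) (pi : policy R K M X) (u : calZ K M X -> R) : R :=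
  \sum_z u z * induced P pi z.

Definition represents (R : realType) (K M : nat) (X : finType)
    (u : calZ K M X -> R) (pref : dist R (calZ K M X) -> dist R (calZ K M X) -> Prop) :
    Prop :=
  forall (P Q : dist R (Omega K M X)) (pi rho : policy R K M X),
    pref (induced P pi) (induced Q rho) <-> value P pi u >= value Q rho u.

Definition additive_utility (R : realType) (K M : nat) (X : finType)
    (u : calZ K M X -> R) : Prop :=
  exists uk : 'I_K -> 'I_K -> 'I_M -> X -> R,
    forall (d : 'I_K) (y : {ffun 'I_K -> 'I_M}) (x : X),
      u (d, y, x) = \sum_(k < K) uk k d (y k) x.

(* [pref p q] reads "p is weakly preferred to q". *)
Definition strict (T : Type) (pref : T -> T -> Prop) (p q : T) : Prop :=
  pref p q /\ ~ pref q p.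

Definition indiff (T : Type) (pref : T -> T -> Prop) (p q : T) : Prop :=
  pref p q /\ pref q p.

Definition completeness (T : Type) (pref : T -> T -> Prop) : Prop :=
  forall p q, pref p q \/ pref q p.

Definition transitivity (T : Type) (pref : T -> T -> Prop) : Prop :=
  forall p q r, pref p q -> pref q r -> pref p r.

Definition independence (R : realType) (S : finType)
    (pref : dist R S -> dist R S -> Prop) : Prop :=
  forall (p q r : dist R S) (a : {i01 R}), 0 < a%:num ->
    strict pref p q -> strict pref (mix a p r) (mix a q r).

Definition continuity (R : realType) (S : finType)
    (pref : dist R S -> dist R S -> Prop) : Prop :=
  forall p q r : dist R S, strict pref p q -> strict pref q r ->
    exists a b : {i01 R},
      [/\ 0 < a%:num < 1, 0 < b%:num < 1,
          strict pref (mix a p r) q & strict pref q (mix b p r)].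

Definition irrelevance_counterfactual_correlation
    (R : realType) (K M : nat) (X : finType)
    (pref : dist R (calZ K M X) -> dist R (calZ K M X) -> Prop) : Prop :=
  forall (p q : dist R (calZ K M X)) (d : 'I_K) (x : X),
    (forall k : 'I_K, Pr p [pred z | coordD z == k] = dirac R d k /\
                      Pr q [pred z | coordD z == k] = dirac R d k) ->
    (forall x' : X, Pr p [pred z | coordX z == x'] = dirac R x x' /\
                    Pr q [pred z | coordX z == x'] = dirac R x x') ->
    (forall (k : 'I_K) (y : 'I_M),
        Pr p [pred z | coordY k z == y] = Pr q [pred z | coordY k z == y]) ->
    indiff pref p q.

(* Main.v *)
(* The first four axioms give a von Neumann-Morgenstern utility [u]: an Archimedean
   supremum argument calibrates each Dirac measure against mixtures of a best and a
   worst one, and peeling off one atom at a time extends this linearly to every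
   lottery. Counterfactual irrelevance then equates the expectations of two lotteries
   with the same marginals: [y] with weight [1/K] and [y0] otherwise, and the uniform
   law on the [K] vectors obtained from [y0] by replacing one coordinate by that of
   [y]. This writes [u (d, y, x)] as a sum of functions of single coordinates. *)

Require Import Defs.
From mathcomp Require Import all_boot all_order all_algebra.
From mathcomp Require Import interval_inference reals.
From mathcomp Require Import boolp classical_sets ring lra.

Set Implicit Arguments.
Unset Strict Implicit.
Unset Printing Implicit Defensive.

Import Order.TTheory GRing.Theory Num.Theory.
Local Open Scope ring_scope.

(** * Mixtures, expectations and conditioning of finite lotteries *)

Section Distributions.
Variables (R : realType) (S : finType).
Implicit Types (p q r m : dist R S) (u : S -> R) (a b : R).

Lemma dist_ext p q : (forall s, p s = q s) -> p = q.
Proof. by move=> pq; apply/val_inj/ffunP. Qed.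

Lemma dist_le1 p s : p s <= 1.
Proof.
by rewrite -(dist_sum1 p) (bigD1 s) //= lerDl sumr_ge0 // => *; apply: dist_ge0.
Qed.

Lemma dist_supp p : exists s, 0 < p s.
Proof.
apply: contrapT => np; have /eqP := dist_sum1 p.
rewrite big1 ?(eq_sym 0) ?oner_eq0 // => s _.
by apply/eqP; rewrite eq_le dist_ge0 andbT leNgt; apply/negP => ps; apply: np; exists s.
Qed.

Lemma dist_eq1 p z : p z = 1 -> p = dirac R z.
Proof.
move=> pz; apply: dist_ext => s; rewrite ffunE.
have [->|nsz] := eqVneq s z; first by rewrite pz.
have := dist_sum1 p; rewrite (bigD1 z) //= pz => /eqP.
rewrite -subr_eq0 addrAC subrr add0r => /eqP/psumr_eq0P -> // t _; exact: dist_ge0.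
Qed.

(** A relation instead of [mix]: the weight can be any real expression, and identities between
    nested mixtures reduce pointwise to [ring] or [field]. *)
Definition mixture a p q m := forall s, m s = a * p s + (1 - a) * q s.

Lemma mixture_mix (a : {i01 R}) p q : mixture a%:num p q (mix a p q).
Proof. by move=> s; rewrite ffunE. Qed.

Lemma mixture_ex a p q : 0 <= a <= 1 -> exists m, mixture a p q m.
Proof. by case/andP=> a0 a1; exists (mix (Itv01 a0 a1) p q); apply: mixture_mix. Qed.

Lemma mixture_inj a p q m m' : mixture a p q m -> mixture a p q m' -> m = m'.
Proof. by move=> h h'; apply: dist_ext => s; rewrite h h'. Qed.

Lemma mixtureC a p q m : mixture a p q m -> mixture (1 - a) q p m.
Proof. by move=> h s; rewrite h; ring. Qed.

Lemma mixture_id a p : mixture a p p p.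
Proof. by move=> s; ring. Qed.

Lemma mixture1 p q : mixture 1 p q p.
Proof. by move=> s; ring. Qed.

Lemma mixture0 p q : mixture 0 p q q.
Proof. by move=> s; ring. Qed.

Definition expect u p := \sum_s u s * p s.

Lemma expect_mixture u a p q m :
  mixture a p q m -> expect u m = a * expect u p + (1 - a) * expect u q.
Proof.
move=> h; rewrite /expect !mulr_sumr -big_split; apply: eq_bigr => s _.
by rewrite h /=; ring.
Qed.

Lemma expect_dirac u z : expect u (dirac R z) = u z.
Proof.
rewrite /expect (bigD1 z) //= ffunE eqxx mulr1 big1 ?addr0 // => s /negPf sz.
by rewrite ffunE sz mulr0.
Qed.

Lemma expect_itv u p a b :
  (forall s, a <= u s <= b) -> a <= expect u p <= b.
Proof.
move=> uab; rewrite -[a]mulr1 -[b]mulr1 -(dist_sum1 p) !mulr_sumr.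
by apply/andP; split; apply: ler_sum => s _; apply: ler_wpM2r; rewrite ?dist_ge0 //;
  case/andP: (uab s).
Qed.

Fact cond_subproof p z (pz : p z != 1) :
  let f := [ffun s => if s == z then 0 else p s / (1 - p z)] in
  [forall s, 0 <= f s] && (\sum_s f s == 1).
Proof.
have lt1 : 0 < 1 - p z by rewrite subr_gt0 lt_neqAle pz dist_le1.
apply/andP; split.
  apply/forallP => s; rewrite ffunE; case: ifP => // _.
  by rewrite divr_ge0 ?dist_ge0 // ltW.
rewrite (bigD1 z) //= ffunE eqxx add0r.
under eq_bigr => s /negPf sz do rewrite ffunE sz.
rewrite -mulr_suml; have := dist_sum1 p; rewrite (bigD1 z) //=.
by move=> /(canRL (addKr _)) ->; rewrite addrC divff ?eqxx ?gt_eqF.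
Qed.

(* [p] conditioned on the complement of [z]. *)
Definition cond p z (pz : p z != 1) : dist R S := Dist (cond_subproof pz).

Lemma mixture_cond p z (pz : p z != 1) :
  mixture (p z) (dirac R z) (cond pz) p.
Proof.
move=> s; rewrite !ffunE; have [->|_] := eqVneq s z; first by rewrite /=; ring.
by rewrite mulr0 add0r mulrC divfK // subr_eq0 eq_sym.
Qed.

End Distributions.

(** * Uniform laws on indexed families *)

Section Uniform.
Variables (R : realType) (S I : finType) (i0 : I) (f : I -> S).

Fact unif_subproof :
  let g := [ffun s => #|I|%:R^-1 * \sum_i (s == f i)%:R : R] in
  [forall s, 0 <= g s] && (\sum_s g s == 1).
Proof.
apply/andP; split.
  by apply/forallP => s; rewrite ffunE mulr_ge0 ?invr_ge0 ?ler0n ?sumr_ge0.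
under eq_bigr do rewrite ffunE.
rewrite -mulr_sumr exchange_big /=; under eq_bigr => i _.
  rewrite (bigD1 (f i)) //= eqxx big1 ?addr0; last by move=> s /negPf->.
  over.
rewrite sumr_const mulVf // pnatr_eq0 -lt0n; apply/card_gt0P; by exists i0.
Qed.

(* The law of [f i] for [i] uniform on [I]; [i0] only witnesses that [I] is
   nonempty. *)
Definition unif : dist R S := Dist unif_subproof.

Lemma expect_unif u : expect u unif = #|I|%:R^-1 * \sum_i u (f i).
Proof.
rewrite /expect; under eq_bigr do rewrite ffunE mulrCA mulr_sumr.
rewrite -mulr_sumr exchange_big /=; congr (_ * _); apply: eq_bigr => i _.
rewrite (bigD1 (f i)) //= eqxx mulr1 big1 ?addr0 // => s /negPf->.
by rewrite mulr0.
Qed.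

End Uniform.

Lemma Pr_expect (R : realType) (S : finType) (p : dist R S) (E : pred S) :
  Pr p E = expect (fun s => (E s)%:R) p.
Proof.
rewrite /Pr /expect big_mkcond; apply: eq_bigr => s _.
by case: (E s); rewrite ?mul1r ?mul0r.
Qed.

(** Supplies best and worst outcomes. The element [x0] answers for the empty list, so [b] is not
    claimed to lie in [s]. *)
Lemma total_max (T : eqType) (r : T -> T -> Prop) (x0 : T) (s : seq T) :
  completeness r -> transitivity r -> exists b, forall x, x \in s -> r b x.
Proof.
move=> rC rT; elim: s => [|y s [b bs]]; first by exists x0.
case: (rC b y) => [by_|yb].
  by exists b => x; rewrite inE => /orP[/eqP->|/bs].
exists y => x; rewrite inE => /orP[/eqP->|/bs]; last exact: rT.
by case: (rC y y).
Qed.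

(** * The von Neumann-Morgenstern representation *)

Section VNM.
Variables (R : realType) (S : finType) (pref : dist R S -> dist R S -> Prop).
Implicit Types (p q r m : dist R S) (u : S -> R) (a b : R).
Hypotheses (prefC : completeness pref) (prefT : transitivity pref).
Hypotheses (prefI : independence pref) (prefA : continuity pref).

Local Notation "p >- q" := (strict pref p q) (at level 70).
Local Notation "p ~~~ q" := (indiff pref p q) (at level 70).

Lemma pref_refl p : pref p p.
Proof. by case: (prefC p p). Qed.

Lemma not_pref p q : ~ pref p q -> q >- p.
Proof. by move=> npq; split=> //; case: (prefC p q). Qed.

Lemma strict_pref_trans p q r : p >- q -> pref q r -> p >- r.
Proof.
move=> [pq nqp] qr; split; first exact: prefT qr.
by move=> rp; apply: nqp; apply: prefT rp.
Qed.

Lemma pref_strict_trans p q r : pref p q -> q >- r -> p >- r.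
Proof.
move=> pq [qr nrq]; split; first exact: prefT qr.
by move=> rp; apply: nrq; apply: prefT pq.
Qed.

Lemma indiff_sym p q : p ~~~ q -> q ~~~ p.
Proof. by case. Qed.

Lemma indiff_trans p q r : p ~~~ q -> q ~~~ r -> p ~~~ r.
Proof. by move=> [? ?] [? ?]; split; apply: prefT; eassumption. Qed.

Lemma strict_mixture a p q r m m' : 0 < a <= 1 ->
  mixture a p r m -> mixture a q r m' -> p >- q -> m >- m'.
Proof.
case/andP=> a0 a1 hm hm' pq; pose t := Itv01 (ltW a0) a1.
rewrite (mixture_inj hm (mixture_mix t p r)) (mixture_inj hm' (mixture_mix t q r)).
exact: prefI.
Qed.

(** Independence first gives that [m] beats [q]. Then [m'] is a mixture of [q] and [m] with weight
    [b / a] on [m], to be compared with [m] mixed with itself. *)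
Lemma strict_mono a b p q m m' : 0 <= b -> b < a -> a <= 1 ->
  mixture a p q m -> mixture b p q m' -> p >- q -> m >- m'.
Proof.
move=> b0 ba a1 hm hm' pq.
have a0 : 0 < a := le_lt_trans b0 ba.
have mq : m >- q.
  by apply: strict_mixture hm (mixture_id _ _) pq; rewrite a0.
apply: (@strict_mixture (1 - b / a) m q m m m' _ _ _ mq).
- rewrite subr_gt0 ltr_pdivrMr // mul1r ba /= gerBl divr_ge0 //; exact: ltW.
- exact: mixture_id.
- by move=> s; rewrite hm' hm; field; rewrite gt_eqF.
Qed.

(* Given [s >- p], every mixture of [s] and [q] beats [q ~~~ p], so a mixture
   arbitrarily close to [m'] beats [m]; this contradicts continuity if [m >- m']. *)
Lemma indiff_mixture_aux a p q r m m' : 0 < a < 1 -> p ~~~ q ->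
  mixture a p r m -> mixture a q r m' -> m >- m' -> False.
Proof.
case/andP=> a0 a1 [pq qp] hm hm' mm'.
have a01 : 0 < a <= 1 by rewrite a0 ltW.
have [[s [sp|ps]]|none] := pselect (exists s, s >- p \/ p >- s).
- have [s' hs'] : exists s', mixture a s r s' by apply: mixture_ex; rewrite !ltW.
  have [b [c [_ /andP[c0 c1] _ mc]]] := prefA (strict_mixture a01 hs' hm sp) mm'.
  have c01 : 0 < c%:num <= 1 by rewrite c0 ltW.
  have kq : mix c s q >- q.
    apply: strict_mixture c01 (mixture_mix _ _ _) (mixture_id _ _) _.
    exact: strict_pref_trans pq.
  have kp : mix c s q >- p := strict_pref_trans kq qp.
  (* Interchanging the two mixtures, [mix c s' m'] is also [mix c s q] mixed with [r] at weight [a],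
     so it beats [m]. *)
  have [_] : mix c s' m' >- m; last by apply; case: mc.
  apply: strict_mixture a01 _ hm kp => t.
  by rewrite !mixture_mix hs' hm'; ring.
(* Mirror image, with a lottery [s] worse than [p]. *)
- have [s' hs'] : exists s', mixture a s r s' by apply: mixture_ex; rewrite !ltW.
  have qs : q >- s := pref_strict_trans qp ps.
  have [c [b [/andP[c0 c1] _ cm _]]] := prefA mm' (strict_mixture a01 hm' hs' qs).
  have c01 : 0 < 1 - c%:num <= 1 by rewrite subr_gt0 c1 gerBl ltW.
  have pk : p >- mix c p s.
    apply: strict_mixture c01 (mixture_id _ _) (mixtureC (mixture_mix _ _ _)) ps.
  have qk : q >- mix c p s := pref_strict_trans qp pk.
  have [_] : m' >- mix c m s'; last by apply; case: cm.
  apply: strict_mixture a01 hm' _ qk => t.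
  by rewrite !mixture_mix hs' hm; ring.
(* No lottery is strictly comparable to [p], so all are indifferent. *)
- have all t : pref p t /\ pref t p.
    by split; apply: contrapT => /not_pref h; apply: none; exists t; [left|right].
  by case: mm' => _; apply; apply: prefT (all m).1; case: (all m').
Qed.

Lemma indiff_mixture a p q r m m' : 0 <= a <= 1 -> p ~~~ q ->
  mixture a p r m -> mixture a q r m' -> m ~~~ m'.
Proof.
move=> /andP[]; rewrite le0r => /orP[/eqP-> _ _ hm hm'|a0].
  rewrite (mixture_inj hm (mixture0 _ _)) (mixture_inj hm' (mixture0 _ _)).
  by split; apply: pref_refl.
rewrite le_eqVlt => /orP[/eqP-> pq hm hm'|a1 pq hm hm'].
  by rewrite (mixture_inj hm (mixture1 _ _)) (mixture_inj hm' (mixture1 _ _)).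
have a01 : 0 < a < 1 by rewrite a0.
split; apply: contrapT => /not_pref.
- exact: indiff_mixture_aux a01 (indiff_sym pq) hm' hm.
- exact: indiff_mixture_aux a01 pq hm hm'.
Qed.

(** The weight is the supremum of those whose mixture is still weakly worse than [q]; continuity
    excludes a strict preference there in either direction. *)
Lemma calibration p q r : p >- r -> pref p q -> pref q r ->
  exists2 c, 0 <= c <= 1 & forall m, mixture c p r m -> q ~~~ m.
Proof.
move=> pr pq qr.
(* Ties of [q] with [r] or [p] give the weights 0 and 1. Otherwise both comparisons are strict, as
   continuity requires. *)
have [rq|/not_pref qr'] := pselect (pref r q).
  exists 0 => [|m hm]; first by rewrite lexx ler01.
  by rewrite (mixture_inj hm (mixture0 _ _)).
have [qp|/not_pref pq'] := pselect (pref q p).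
  exists 1 => [|m hm]; first by rewrite ler01 lexx.
  by rewrite (mixture_inj hm (mixture1 _ _)).
pose A : set R :=
  fun c => 0 <= c <= 1 /\ exists2 m, mixture c p r m & pref q m.
have A0 : A 0 by split; [rewrite lexx ler01 | exists r => //; apply: mixture0].
have hub : has_ubound A by exists 1 => c [/andP[]].
have c0 : 0 <= sup A by apply: ub_le_sup.
have c1 : sup A <= 1 by apply: ge_sup; [exists 0 | move=> c [/andP[]]].
exists (sup A) => [|m hm]; first by rewrite c0.
split; apply: contrapT => /not_pref.
(* Some mixture of weight [b * sup A] still beats [q], so this weight bounds [A] from above; as
   [b < 1], this forces [sup A = 0] and [m = r]. *)
- move=> mq.
  have [b [_ [/andP[b0 b1] _ kq _]]] := prefA mq qr'.
  have hk : mixture (b%:num * sup A) p r (mix b m r).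
    by move=> s; rewrite mixture_mix hm; ring.
  have : sup A <= b%:num * sup A.
    apply: ge_sup => [|c' [/andP[c'0 c'1] [m' hm' qm']]]; first by exists 0.
    rewrite leNgt; apply/negP => ltc.
    have [_] := strict_mono (mulr_ge0 (ltW b0) c0) ltc c'1 hm' hk pr.
    by apply; case: (strict_pref_trans kq qm').
  move=> le_c; have c00 : sup A = 0 by nra.
  rewrite c00 in hm; case: mq => _; apply.
  by rewrite (mixture_inj hm (mixture0 _ _)).
(* Dually, a weight moved from [sup A] towards 1 stays in [A], which forces [sup A = 1] and
   [m = p]. *)
- move=> qm.
  have [_ [b [_ /andP[b0 b1] _ qk]]] := prefA pq' qm.
  have hk : mixture (b%:num + (1 - b%:num) * sup A) p r (mix b p m).
    by move=> s; rewrite mixture_mix hm; ring.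
  have : b%:num + (1 - b%:num) * sup A <= sup A.
    apply: ub_le_sup => //; split; first by apply/andP; split; nra.
    by exists (mix b p m) => //; case: qk.
  move=> le_c; have c11 : sup A = 1 by nra.
  rewrite c11 in hm; case: qm => _; apply.
  by rewrite (mixture_inj hm (mixture1 _ _)).
Qed.

(** Induction on the size of the support: conditioning away an atom [z] shrinks it, and affinity of
    [expect] recombines the weights. *)
Lemma indiff_expect p0 p1 u :
    (forall z, 0 <= u z <= 1) ->
    (forall z m, mixture (u z) p1 p0 m -> dirac R z ~~~ m) ->
  forall p m, mixture (expect u p) p1 p0 m -> p ~~~ m.
Proof.
move=> u01 uP p; have [n] := ubnP #|[set s | p s != 0]|%SET.
elim: n p => // n IHn p; rewrite ltnS => supp_p m hm.
have [z pz0] := dist_supp p.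
have [pz1|pz] := eqVneq (p z) 1.
  move: hm; rewrite (dist_eq1 pz1) expect_dirac; exact: uP.
have pz01 : 0 <= p z <= 1 by rewrite dist_ge0 dist_le1.
have pz01' : 0 <= 1 - p z <= 1 by rewrite subr_ge0 dist_le1 gerBl dist_ge0.
have /(expect_mixture u) := mixture_cond pz; rewrite expect_dirac => Ep.
(* Two substitutions: [k] is [p] with the atom replaced by its calibrated mixture [mz]; replacing
   the conditional law by [m'] as well then yields [m]. *)
have [mz hmz] := mixture_ex p1 p0 (u01 z).
have [m' hm'] := mixture_ex p1 p0 (expect_itv (cond pz) u01).
have [k hk] := mixture_ex mz (cond pz) pz01.
apply: (@indiff_trans p k).
  exact: indiff_mixture pz01 (uP _ _ hmz) (mixture_cond pz) hk.
apply: (@indiff_mixture _ _ m' _ _ _ pz01' _ (mixtureC hk)); last first.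
  by move=> s; rewrite hm Ep hm' hmz; ring.
apply: IHn hm'; apply: leq_trans supp_p; apply: proper_card.
apply/properP; split.
  apply/fintype.subsetP => s; rewrite !inE ffunE.
  by case: (s == z); [rewrite eqxx | apply: contraNneq => ->; rewrite mul0r].
by exists z; rewrite !inE ?ffunE ?eqxx // gt_eqF.
Qed.

Theorem vnm_representation :
  exists u : S -> R, forall p q, pref p q <-> expect u q <= expect u p.
Proof.
have [[z0 _]|S0] := pselect (exists z : S, True); last first.
  by exists (fun=> 0) => p; have [z] := dist_supp p; case: S0; exists z.
have [z1 z1P] := @total_max _ (fun x y => pref (dirac R x) (dirac R y)) z0
  (enum S) (fun x y => prefC _ _) (fun x y z => @prefT _ _ _).
have [z2 z2P] := @total_max _ (fun x y => pref (dirac R y) (dirac R x)) z0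
  (enum S) (fun x y => prefC _ _) (fun x y z h h' => prefT h' h).
have ge_z2 z : pref (dirac R z) (dirac R z2) by apply: z2P; rewrite mem_enum.
have le_z1 z : pref (dirac R z1) (dirac R z) by apply: z1P; rewrite mem_enum.
have [z21|/not_pref z12] := pselect (pref (dirac R z2) (dirac R z1)).
  exists (fun=> 0).
  (* All outcomes tie, so both anchors may be [z2] and every mixture of them collapses. *)
  have bot p : p ~~~ dirac R z2.
    apply: (@indiff_expect (dirac R z2) (dirac R z2) (fun=> 0)).
    - by move=> _; rewrite lexx ler01.
    - move=> z m hm; rewrite (mixture_inj hm (mixture_id _ _)).
      by split; [apply: ge_z2 | apply: prefT z21 _].
    - exact: mixture_id.
  move=> p q; split=> _; last by apply: prefT (bot p).1 (bot q).2.
  by rewrite /expect !big1 // => z _; rewrite mul0r.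
have /choice[u uP] : forall z, exists c, 0 <= c <= 1 /\
    forall m, mixture c (dirac R z1) (dirac R z2) m -> dirac R z ~~~ m.
  by move=> z; have [c] := calibration z12 (le_z1 z) (ge_z2 z); exists c.
have u01 z : 0 <= u z <= 1 := (uP z).1.
(* Each lottery ties with the best-worst mixture weighted by its expected utility, and [strict_mono]
   orders these mixtures by weight. *)
exists u => p q.
have [m hm] := mixture_ex (dirac R z1) (dirac R z2) (expect_itv p u01).
have [n hn] := mixture_ex (dirac R z1) (dirac R z2) (expect_itv q u01).
have pm := indiff_expect u01 (fun z => (uP z).2) hm.
have qn := indiff_expect u01 (fun z => (uP z).2) hn.
have [/andP[p0 p1] /andP[q0 q1]] := (expect_itv p u01, expect_itv q u01).
split=> [pq|].
  rewrite leNgt; apply/negP => lt_pq.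
  have [_] := strict_mono p0 lt_pq q1 hn hm z12; apply.
  by apply: prefT pm.2 (prefT pq qn.1).
rewrite le_eqVlt => /orP[/eqP eq_qp|lt_qp].
  rewrite eq_qp in hn; rewrite -(mixture_inj hm hn) in qn.
  exact: prefT pm.1 qn.2.
have [mn _] := strict_mono q0 lt_qp p1 hm hn z12.
exact: prefT pm.1 (prefT mn qn.2).
Qed.

End VNM.

(** * Expected utility satisfies the first four axioms *)

Section Converse.
Variables (R : realType) (S : finType) (pref : dist R S -> dist R S -> Prop).
Variable u : S -> R.
Hypothesis prefE : forall p q, pref p q <-> expect u q <= expect u p.

Lemma strict_expect p q : strict pref p q <-> expect u q < expect u p.
Proof.
rewrite /strict !prefE ltNge; split=> [[_ /negP] //|/negP h]; split=> //.
by rewrite ltW // ltNge; apply/negP.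
Qed.

Lemma expect_vnm_axioms :
  [/\ completeness pref, transitivity pref, independence pref & continuity pref].
Proof.
split.
- by move=> p q; rewrite !prefE; apply/orP; apply: le_total.
- by move=> p q r; rewrite !prefE => qp rq; apply: le_trans qp.
- move=> p q r a a0; rewrite !strict_expect !(expect_mixture u (mixture_mix _ _ _)).
  by move=> qp; rewrite ltrD2r ltr_pM2l.
- move=> p q r; rewrite !strict_expect => qp rq.
  set P := expect u p in qp *; set Q := expect u q in qp rq *.
  (* At weight [t] the mixture of [p] and [r] has expectation exactly [Q]; the midpoints of [t] with
     1 and with 0 lie strictly on either side. *)
  set T := expect u r in rq *; pose t := (Q - T) / (P - T).
  have PT : 0 < P - T by lra.
  have t0 : 0 < t by rewrite divr_gt0 // subr_gt0.
  have t1 : t < 1 by rewrite ltr_pdivrMr // mul1r; lra.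
  have tQ : t * (P - T) = Q - T by rewrite divfK // gt_eqF.
  have a0 : 0 <= (1 + t) / 2 by lra.
  have a1 : (1 + t) / 2 <= 1 by lra.
  have b0 : 0 <= t / 2 by lra.
  have b1 : t / 2 <= 1 by lra.
  exists (Itv01 a0 a1), (Itv01 b0 b1).
  split; [| |apply/strict_expect|apply/strict_expect];
    by rewrite ?(expect_mixture u (mixture_mix _ _ _)) /= -/P -/Q -/T; nra.
Qed.

End Converse.

(** * Uniqueness up to a positive affine map *)

Lemma expect_order_affine (R : realType) (S : finType) (u v : S -> R) :
  (forall p q : dist R S, expect u q <= expect u p <-> expect v q <= expect v p) ->
  exists a b : R, 0 < a /\ forall z, v z = a * u z + b.
Proof.
move=> uv.
have [[z0 _]|S0] := pselect (exists z : S, True); last first.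
  by exists 1, 0; split=> [|z]; [apply: ltr01 | case: S0; exists z].
have uvE p q : expect u p = expect u q -> expect v p = expect v q.
  move=> /eqP; rewrite eq_le => /andP[/uv pq /uv qp].
  by apply/eqP; rewrite eq_le pq qp.
have leC : completeness (fun x y => u x <= u y).
  by move=> x y; apply/orP; apply: le_total.
have [z2 z2P] := total_max z0 (enum S) leC (fun x y z => @le_trans _ _ _ _ _).
have [z1 z1P] := @total_max _ (fun x y => u y <= u x) z0 (enum S)
  (fun x y => leC y x) (fun x y z h h' => le_trans h' h).
have ge_z2 z : u z2 <= u z by apply: z2P; rewrite mem_enum.
have le_z1 z : u z <= u z1 by apply: z1P; rewrite mem_enum.
have := ge_z2 z1; rewrite le_eqVlt => /orP[/eqP u21|lt_u].
  (* Here [u] is constant, hence so is [v], and a translation suffices. *)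
  exists 1, (v z1 - u z1); split=> [|z]; first exact: ltr01.
  have uz : u z = u z1 by apply/eqP; rewrite eq_le le_z1 -u21 ge_z2.
  have := uvE (dirac R z) (dirac R z1); rewrite !expect_dirac => /(_ uz) ->.
  by rewrite uz; ring.
have lt_v : v z2 < v z1.
  have := uv (dirac R z2) (dirac R z1); rewrite !expect_dirac => uv21.
  by rewrite ltNge; apply/negP => /uv21; rewrite leNgt lt_u.
have u12 : 0 < u z1 - u z2 by rewrite subr_gt0.
exists ((v z1 - v z2) / (u z1 - u z2)),
  (v z2 - (v z1 - v z2) / (u z1 - u z2) * u z2).
split=> [|z]; first by rewrite divr_gt0 ?subr_gt0.
(* With weight [t] on [z1], the mixture of [z1] and [z2] ties with [z] under [u], hence under [v];
   this makes [v z] affine in [u z]. *)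
pose t := (u z - u z2) / (u z1 - u z2).
have t01 : 0 <= t <= 1.
  rewrite divr_ge0 ?subr_ge0 //=.
  by rewrite ler_pdivrMr // mul1r lerD2r.
have [m hm] := mixture_ex (dirac R z1) (dirac R z2) t01.
have uz : u z = t * u z1 + (1 - t) * u z2.
  by rewrite /t; field; rewrite gt_eqF.
have := uvE (dirac R z) m.
rewrite !(expect_mixture _ hm) !expect_dirac => /(_ uz) ->.
by rewrite /t; field; rewrite gt_eqF.
Qed.

(** * Policies and states of nature versus joint lotteries *)

Section Policies.
Variables (R : realType) (K M : nat) (X : finType).
Variable pref : dist R (calZ K M X) -> dist R (calZ K M X) -> Prop.
Implicit Types (p q : dist R (calZ K M X)) (u : calZ K M X -> R).

Fact marginal_subproof p :
  let f := [ffun yx : Omega K M X => \sum_(d < K) p (d, yx.1, yx.2)] in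
  [forall w, 0 <= f w] && (\sum_w f w == 1).
Proof.
apply/andP; split.
  by apply/forallP => w; rewrite ffunE sumr_ge0 // => d _; apply: dist_ge0.
under eq_bigr do rewrite ffunE.
rewrite -(dist_sum1 p) exchange_big /=.
rewrite (pair_big xpredT xpredT (fun d (w : Omega K M X) => p (d, w.1, w.2))) /=.
rewrite (reindex (fun z : calZ K M X => (z.1.1, (z.1.2, z.2)))) /=.
  by apply/eqP; apply: eq_bigr => -[[d y] x].
by exists (fun w => (w.1, w.2.1, w.2.2)) => [[[d y] x]|[d [y x]]].
Qed.

Definition marginal p : dist R (Omega K M X) := Dist (marginal_subproof p).

(** Disintegration: the policy is the conditional law of the decision given outcomes and covariates.
    Where the marginal vanishes that quotient is no law, and [insubd] falls back on the Dirac
    measure at [d0], which is multiplied by zero mass. *)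
Lemma induced_surj p : exists P pi, p = induced P pi.
Proof.
have [[[d0 _] _] _] := dist_supp p.
exists (marginal p), (fun y x => insubd (dirac R d0)
  [ffun d => p (d, y, x) / marginal p (y, x)]).
apply: dist_ext => -[[d y] x]; rewrite ffunE /=.
have mE : marginal p (y, x) = \sum_(d < K) p (d, y, x) by rewrite ffunE.
have [m0|m_neq0] := eqVneq (marginal p (y, x)) 0.
  rewrite m0 mulr0; apply: (psumr_eq0P _ (esym (etrans (esym m0) mE))) => // k _.
  exact: dist_ge0.
have := dist_ge0 (marginal p) (y, x).
move: (marginal p (y, x)) mE m_neq0 => c cE c_neq0 c_ge0.
rewrite insubdK; first by rewrite ffunE divfK.
rewrite -topredE; apply/andP; split.
  by apply/forallP => k; rewrite ffunE divr_ge0 ?dist_ge0.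
under eq_bigr do rewrite ffunE.
by rewrite -mulr_suml -cE divff.
Qed.

Lemma representsE u :
  represents u pref <-> forall p q, pref p q <-> expect u q <= expect u p.
Proof.
split=> [urep p q|urep P Q pi rho]; last exact: urep.
have [P [pi ->]] := induced_surj p; have [Q [rho ->]] := induced_surj q.
exact: urep.
Qed.

(** * Additivity and counterfactual irrelevance *)

Lemma Pr_dirac_supp p (T : finType) (f : calZ K M X -> T) t :
  (forall t', Pr p [pred z | f z == t'] = dirac R t t') ->
  forall z, p z != 0 -> f z = t.
Proof.
move=> pf z; apply: contraNeq => /negPf fzt.
have := pf (f z); rewrite ffunE fzt => /psumr_eq0P h; apply/eqP/h => //=.
by move=> *; apply: dist_ge0.
Qed.

Lemma additive_irrelevance u :
  (forall p q, pref p q <-> expect u q <= expect u p) -> additive_utility u ->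
  irrelevance_counterfactual_correlation pref.
Proof.
move=> urep [uk ukE] p q d x pqD pqX pqY.
(* With decision and covariates fixed, the expectation of an additive utility depends only on the
   marginals of the potential outcomes. *)
have expE (r : dist R (calZ K M X)) :
    (forall k, Pr r [pred z | coordD z == k] = dirac R d k) ->
    (forall x', Pr r [pred z | coordX z == x'] = dirac R x x') ->
    expect u r =
    \sum_(k < K) \sum_(y < M) uk k d y x * Pr r [pred z | coordY k z == y].
  move=> rD rX; transitivity (\sum_z \sum_(k < K) uk k d (coordY k z) x * r z).
    apply: eq_bigr => z _; rewrite -mulr_suml.
    have [->|rz] := eqVneq (r z) 0; first by rewrite !mulr0.
    rewrite -(Pr_dirac_supp rD rz) -(Pr_dirac_supp rX rz).
    by case: z {rz} => -[d' y] x'; rewrite ukE.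
  rewrite exchange_big; apply: eq_bigr => k _.
  rewrite (partition_big (coordY k) xpredT) //=; apply: eq_bigr => y _.
  by rewrite mulr_sumr; apply: eq_bigr => z /eqP->.
have eq_pq : expect u p = expect u q.
  rewrite (expE p (fun k => (pqD k).1) (fun x => (pqX x).1)).
  rewrite (expE q (fun k => (pqD k).2) (fun x => (pqX x).2)).
  by apply: eq_bigr => k _; apply: eq_bigr => y _; rewrite pqY.
by split; apply/urep; rewrite eq_pq.
Qed.

Definition upd (y0 : {ffun 'I_K -> 'I_M}) (k : 'I_K) (a : 'I_M) :
  {ffun 'I_K -> 'I_M} := [ffun j => if j == k then a else y0 j].

Lemma irrelevance_additive u (y0 : {ffun 'I_K -> 'I_M}) :
  (forall p q, pref p q <-> expect u q <= expect u p) ->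
  irrelevance_counterfactual_correlation pref -> additive_utility u.
Proof.
move=> urep irr.
(* The aim is that the values of [u] at the [K] one-coordinate updates sum to [u (d, y, x)] plus
   [K - 1] copies of [u (d, y0, x)]; each summand absorbs an equal share of the surplus. *)
exists (fun k d a x => u (d, upd y0 k a, x) - (K%:R - 1) / K%:R * u (d, y0, x)).
move=> d y x.
(* Index [d] is an arbitrary choice of the one index out of [K] that carries [y]. *)
pose f (j : 'I_K) : calZ K M X := (d, if j == d then y else y0, x).
pose g (j : 'I_K) : calZ K M X := (d, upd y0 j (y j), x).
have Kgt0 : (0 < K)%N by apply: leq_ltn_trans (ltn_ord d).
have K0 : K%:R != 0 :> R by rewrite pnatr_eq0 -lt0n.
have unif_const (T : finType) (h : 'I_K -> calZ K M X) (c : calZ K M X -> T) t :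
    (forall j, c (h j) = t) -> forall t',
    Pr (unif R d h) [pred z | c z == t'] = dirac R t t'.
  move=> ch t'; rewrite Pr_expect expect_unif ffunE.
  under eq_bigr do rewrite /= ch.
  by rewrite sumr_const !card_ord eq_sym -[X in _ * X]mulr_natl mulKf.
have [pq qp] : indiff pref (unif R d f) (unif R d g).
  apply: (irr _ _ d x) => [k|x'|k a]; try by split; apply: unif_const.
  rewrite !Pr_expect !expect_unif; congr (_ * _).
  (* Coordinate [k] equals [y k] at exactly one designated index, [d] for [f] and [k] for [g]; the
     other [K - 1] indices contribute [y0 k]. *)
  rewrite (bigD1 d) //= [RHS](bigD1 k) //= /coordY /= ffunE !eqxx; congr (_ + _).
  rewrite (eq_bigr (fun=> (y0 k == a)%:R)) => [|j /negPf jd]; last by rewrite jd.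
  rewrite [RHS](eq_bigr (fun=> (y0 k == a)%:R)) => [|j /negPf jk]; last first.
    by rewrite ffunE (eq_sym k) jk.
  by rewrite !sumr_const !cardC1.
have : expect u (unif R d f) = expect u (unif R d g).
  by apply/eqP; rewrite eq_le; apply/andP; split; apply/urep.
rewrite !expect_unif card_ord => /mulfI; rewrite invr_eq0 => /(_ K0).
rewrite (bigD1 d) //= {1}/f eqxx (eq_bigr (fun=> u (d, y0, x))); last first.
  by move=> j /negPf jd; rewrite /f jd.
rewrite sumr_const cardC1 card_ord => E.
rewrite big_split /= sumr_const card_ord -E -subn1.
rewrite -[_ *+ (K - 1)]mulr_natl natrB; last exact: Kgt0.
rewrite -[_ *+ K]mulr_natl; field.
exact: K0.
Qed.

End Policies.

Theorem theorem3 (R : realType) (K M : nat) (hK : (2 <= K)%N) (hM : (2 <= M)%N)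
    (X : finType) (pref : dist R (calZ K M X) -> dist R (calZ K M X) -> Prop) :
  ([/\ completeness pref, transitivity pref, independence pref, continuity pref
     & irrelevance_counterfactual_correlation pref]
   <->
   exists u : calZ K M X -> R, additive_utility u /\ represents u pref)
  /\
  (forall u v : calZ K M X -> R,
     additive_utility u -> additive_utility v ->
     represents u pref -> represents v pref ->
     exists a b : R, 0 < a /\ forall z : calZ K M X, v z = a * u z + b).
Proof.
split; first split.
- case=> prefC prefT prefI prefA irr.
  have [u urep] := vnm_representation prefC prefT prefI prefA.
  exists u; split; last exact/representsE.
  (* The base point [y0] is the zero outcome vector. *)
  exact: (irrelevance_additive [ffun=> Ordinal (ltnW hM)] urep irr).
- case=> u [uadd /representsE urep].
  have [? ? ? ?] := expect_vnm_axioms urep.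
  by split=> //; apply: additive_irrelevance uadd.
- move=> u v _ _ /representsE urep /representsE vrep.
  by apply: expect_order_affine => p q; rewrite -urep.
Qed.
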